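(* Let $(X,m_s)$ be a complete $M_s$-metric space and let $T:X\to X$ be a self mapping for which there is a constant $k\in[0,1)$ such that $$m_s(Tx,Tx,Ty)\le k\, m_s(x,x,y)\qquad\text{for all } x,y\in X.$$ Then $T$ has a unique fixed point $u\in X$. Moreover, $m_s(u,u,u)=0$.
   Context: For a nonempty set $X$ and a function $m_s:X^3\to[0,\infty)$ write $$m_{s_{x,y,z}}:=\min\{m_s(x,x,x),m_s(y,y,y),m_s(z,z,z)\},\qquad M_{s_{x,y,z}}:=\max\{m_s(x,x,x),m_s(y,y,y),m_s(z,z,z)\}.$$ The function $m_s$ is an $M_s$-metric on $X$, and $(X,m_s)$ is an $M_s$-metric space, if for all $x,y,z,t\in X$: (1) $m_s(x,x,x)=m_s(y,y,y)=m_s(x,x,y)$ if and only if $x=y$; (2) $m_{s_{x,y,z}}\le m_s(x,y,z)$; (3) $m_s(x,x,y)=m_s(y,y,x)$; (4) $m_s(x,y,z)-m_{s_{x,y,z}}\le (m_s(x,x,t)-m_{s_{x,x,t}})+(m_s(y,y,t)-m_{s_{y,y,t}})+(m_s(z,z,t)-m_{s_{z,z,t}})$. A sequence $\{x_n\}$ in $X$ converges to $x\in X$ if $\lim_{n\to\infty}(m_s(x_n,x_n,x)-m_{s_{x_n,x_n,x}})=0$. A sequence $\{x_n\}$ is $M_s$-Cauchy if the limits $\lim_{n,m\to\infty}(m_s(x_n,x_n,x_m)-m_{s_{x_n,x_n,x_m}})$ and $\lim_{n,m\to\infty}(M_{s_{x_n,x_n,x_m}}-m_{s_{x_n,x_n,x_m}})$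 exist and are finite. The space $(X,m_s)$ is complete if every $M_s$-Cauchy sequence $\{x_n\}$ converges to a point $x\in X$ such that $\lim_{n\to\infty}(m_s(x_n,x_n,x)-m_{s_{x_n,x_n,x}})=0$ and $\lim_{n\to\infty}(M_{s_{x_n,x_n,x}}-m_{s_{x_n,x_n,x}})=0$. *)

(* Defs.v *)
From HB Require Import structures.
From mathcomp Require Import all_boot all_order all_algebra.
From mathcomp Require Import all_classical all_reals all_analysis.
Import numFieldNormedType.Exports.
Import Order.TTheory GRing.Theory Num.Theory.

Set Implicit Arguments.
Unset Strict Implicit.
Unset Printing Implicit Defensive.

Local Open Scope classical_set_scope.
Local Open Scope ring_scope.

Section MsMetric.
Variables (R : realType) (X : Type) (m : X -> X -> X -> R).

Definition Ms_min (x y z : X) : R :=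
  Num.min (m x x x) (Num.min (m y y y) (m z z z)).

Definition Ms_max (x y z : X) : R :=
  Num.max (m x x x) (Num.max (m y y y) (m z z z)).

Record is_Ms_metric : Prop := IsMsMetric {
  Ms_ge0 : forall x y z, 0 <= m x y z ;
  Ms_sep : forall x y, (m x x x = m y y y /\ m y y y = m x x y) <-> x = y ;
  Ms_min_le : forall x y z, Ms_min x y z <= m x y z ;
  Ms_sym : forall x y, m x x y = m y y x ;
  Ms_ineq : forall x y z t,
    m x y z - Ms_min x y z <=
      (m x x t - Ms_min x x t) + (m y y t - Ms_min y y t)
      + (m z z t - Ms_min z z t)
}.

Definition Ms_converges (u : nat -> X) (x : X) : Prop :=
  m (u n) (u n) x - Ms_min (u n) (u n) x @[n --> \oo] --> (0 : R).

(* The double limits are taken along the product filter: both indices tend to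
   infinity independently. The limit is required to lie in R, hence finite. *)
Definition Ms_cauchy (u : nat -> X) : Prop :=
  (exists l : R,
     m (u p.1) (u p.1) (u p.2) - Ms_min (u p.1) (u p.1) (u p.2)
       @[p --> (\oo, \oo)] --> l) /\
  (exists l : R,
     Ms_max (u p.1) (u p.1) (u p.2) - Ms_min (u p.1) (u p.1) (u p.2)
       @[p --> (\oo, \oo)] --> l).

Definition Ms_complete : Prop :=
  forall u : nat -> X, Ms_cauchy u ->
    exists x : X, Ms_converges u x /\
      Ms_max (u n) (u n) x - Ms_min (u n) (u n) x @[n --> \oo] --> (0 : R).

End MsMetric.

(* Main.v *)
Require Import Defs.
From mathcomp Require Import all_boot all_order all_algebra.
From mathcomp Require Import all_classical all_reals all_analysis.
From mathcomp Require Import lra.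

(** Write [d x y] for [m x x y] and let [x_n] be the orbit of any point [a].
    The proof is Banach's, with two twists: self-distances need not vanish,
    and the triangle inequality [Ms_ineq] holds only for [d] corrected by the minimum
    of the self-distances, with a factor 2 that blocks the usual telescoping of
    [d x_n x_(n+p)] along the intermediate terms.

    Telescoping is replaced by a bound on the whole orbit.  Inequality [Ms_ineq]
    through the single point [T a], and one use of the contraction, give
      [d a x_(j+1) <= m a a a + 2 d a (T a) + k d a x_j],
    so that [d a x_j <= B] for all [j] (lemma [orbit_bounded]).  Contracting
    [n] times yields [d x_n x_(n+j) <= k^n B] (lemma [orbit_decay]), and with
    [j = 0] the self-distances along the orbit tend to 0.  Hence both limits in
    the definition of a Cauchy sequence are 0, and completeness provides a
    limit [u] of the orbit.

    The second limit in the definition of completeness forces [m u u u = 0],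
    because the self-distances of [x_n] vanish in the limit; the correction
    terms then disappear and [d x_n u] itself tends to 0.  By contraction
    [d x_(n+1) (T u)] tends to 0 as well, so [Ms_ineq] through [x_(n+1)] gives
    [d u (T u) = 0].  As the self-distances of [u] and [T u] are 0 too, [Ms_sep]
    identifies the two points.
    Uniqueness, and the value 0 of [m u u u], hold because a nonnegative [r]
    with [r <= k r] and [k < 1] is 0. *)

Import numFieldNormedType.Exports.
Import Order.TTheory GRing.Theory Num.Theory.

Set Implicit Arguments.
Unset Strict Implicit.
Unset Printing Implicit Defensive.

Local Open Scope classical_set_scope.
Local Open Scope ring_scope.

Lemma contracted_eq0 (R : realType) (k r : R) :
  k < 1 -> 0 <= r -> r <= k * r -> r = 0.
Proof. by move=> k1 r0 rk; nra. Qed.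

Lemma cvg0D (R : realType) (I : Type) (F : set_system I) (f g : I -> R) :
  Filter F -> f @ F --> (0 : R) -> g @ F --> (0 : R) ->
  f i + g i @[i --> F] --> (0 : R).
Proof. by move=> FF f0 g0; rewrite -[X in _ --> X]addr0; exact: cvgD. Qed.

Lemma squeeze_cvg0 (R : realType) (I : Type) (F : set_system I) (f g : I -> R) :
  Filter F -> (forall i, 0 <= f i <= g i) -> g @ F --> (0 : R) ->
  f @ F --> (0 : R).
Proof.
move=> FF fg g0; apply: (@squeeze_cvgr _ _ _ _ (fun=> 0) g) => //.
- by apply: nearW.
- exact: cvg_cst.
Qed.

Lemma le0_of_cvg0 (R : realType) (c : R) (f : nat -> R) :
  (forall n, c <= f n) -> f n @[n --> \oo] --> (0 : R) -> c <= 0.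
Proof.
move=> cf f0; rewrite -(cvg_lim (@Rhausdorff R) f0).
apply: limr_ge; first by apply/cvg_ex; exists 0.
exact: nearW.
Qed.

Section MsMetricTheory.
Variables (R : realType) (X : Type) (m : X -> X -> X -> R).
Hypothesis m_metric : is_Ms_metric m.

Let m_ge0 x y z : 0 <= m x y z. Proof. exact: Ms_ge0. Qed.

Lemma Ms_min_ge0 x y z : 0 <= Ms_min m x y z.
Proof. by rewrite /Ms_min !le_min !m_ge0. Qed.

Lemma Ms_min_le1 x y z : Ms_min m x y z <= m x x x.
Proof. by rewrite /Ms_min ge_min lexx. Qed.

Lemma Ms_max_le_add x y : Ms_max m x x y <= m x x x + m y y y.
Proof. by rewrite /Ms_max !ge_max lerDl lerDr !m_ge0. Qed.

Lemma Ms_max_ge3 x y z : m z z z <= Ms_max m x y z.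
Proof. by rewrite /Ms_max !le_max lexx !orbT. Qed.

(** Dropping the corrections on the right of [Ms_ineq] costs nothing; dropping the
    one on the left costs at most a self-distance. *)
Lemma Ms_triangle x y t : m x x y <= m x x x + (m x x t *+ 2 + m y y t).
Proof.
have := Ms_ineq m_metric x x y t; have := Ms_min_le1 x x y.
have := Ms_min_ge0 x x t; have := Ms_min_ge0 y y t.
lra.
Qed.

Lemma Ms_eq0 x y : m x x x = 0 -> m y y y = 0 -> m x x y = 0 -> x = y.
Proof. by move=> x0 y0 xy0; apply/(Ms_sep m_metric); rewrite x0 y0 xy0. Qed.

(** Taking [i = j] in the hypothesis controls the self-distances as well, so
    that both corrected quantities in the definition have limit 0. *)
Lemma Ms_cauchy_of_decay (x : nat -> X) (e : nat -> R) :
  (forall i j, m (x i) (x i) (x j) <= e i + e j) ->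
  e n @[n --> \oo] --> (0 : R) -> Ms_cauchy m x.
Proof.
move=> xe e0.
(* The double of the hypothesis: [Ms_max] is at most the sum of the two
   self-distances, which are bounded by [e i + e i] and [e j + e j]. *)
have e2 : (e p.1 + e p.2) + (e p.1 + e p.2) @[p --> (\oo, \oo)] --> (0 : R).
  have c1 : e p.1 @[p --> (\oo, \oo)] --> (0 : R).
    by apply: (@cvg_comp _ _ _ fst e _ _ _ _ e0); exact: cvg_fst.
  have c2 : e p.2 @[p --> (\oo, \oo)] --> (0 : R).
    by apply: (@cvg_comp _ _ _ snd e _ _ _ _ e0); exact: cvg_snd.
  by do 2 apply: cvg0D.
split; exists 0; apply: squeeze_cvg0 e2 => -[i j] /=.
  have := Ms_min_le m_metric (x i) (x i) (x j).
  have := Ms_min_ge0 (x i) (x i) (x j).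
  by have := m_ge0 (x i) (x i) (x j); have := xe i j; lra.
have := Ms_max_le_add (x i) (x j); have := xe i i; have := xe j j.
have := Ms_min_ge0 (x i) (x i) (x j); have := Ms_min_le1 (x i) (x i) (x j).
have : m (x i) (x i) (x i) <= Ms_max m (x i) (x i) (x j).
  by rewrite /Ms_max le_max lexx.
lra.
Qed.

Section Contraction.
Variables (T : X -> X) (k : R).
Hypotheses (k_ge0 : 0 <= k) (k_lt1 : k < 1).
Hypothesis T_contr : forall x y, m (T x) (T x) (T y) <= k * m x x y.

Lemma fixpoint_self_eq0 u : T u = u -> m u u u = 0.
Proof.
move=> Tu; apply: (contracted_eq0 k_lt1) => //.
by have := T_contr u u; rewrite Tu.
Qed.

Lemma fixpoint_unique u v : T u = u -> T v = v -> u = v.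
Proof.
move=> Tu Tv; apply: Ms_eq0; try exact: fixpoint_self_eq0.
apply: (contracted_eq0 k_lt1) => //.
by have := T_contr u v; rewrite Tu Tv.
Qed.

(** The fixed point of the affine map
    [D |-> m a a a + 2 * m a a (T a) + k * D], which dominates the step from
    [m a a x_j] to [m a a x_(j+1)] along the orbit of [a]. *)
Definition orbit_bound (a : X) : R := (m a a a + m a a (T a) *+ 2) / (1 - k).

Lemma orbit_bound_eq a :
  orbit_bound a = m a a a + m a a (T a) *+ 2 + k * orbit_bound a.
Proof.
have : orbit_bound a * (1 - k) = m a a a + m a a (T a) *+ 2.
  by rewrite /orbit_bound divfK // subr_eq0 gt_eqF.
lra.
Qed.

Lemma orbit_bound_ge0 a : 0 <= orbit_bound a.
Proof.
apply: divr_ge0; last by rewrite subr_ge0 ltW.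
by rewrite addr_ge0 ?mulrn_wge0.
Qed.

(** The triangle inequality goes through [T a] rather than through the
    penultimate term: the term left over is then a distance between two images
    of [T], to which the contraction applies, and the factor 2 falls on a
    constant. *)
Lemma orbit_bounded a j : m a a (iter j T a) <= orbit_bound a.
Proof.
elim: j => [|j IH] /=; rewrite orbit_bound_eq.
  by have := mulr_ge0 k_ge0 (orbit_bound_ge0 a); have := m_ge0 a a (T a); lra.
have := Ms_triangle a (T (iter j T a)) (T a).
rewrite (Ms_sym m_metric (T (iter j T a))).
have := T_contr a (iter j T a).
by have := ler_wpM2l k_ge0 IH; lra.
Qed.

Lemma orbit_decay a n j :
  m (iter n T a) (iter n T a) (iter (n + j) T a) <= k ^+ n * orbit_bound a.
Proof.
elim: n => [|n IH] /=; first by rewrite mul1r orbit_bounded.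
apply: le_trans (T_contr _ _) _.
by rewrite exprS -mulrA ler_wpM2l.
Qed.

Lemma orbit_decay_cvg0 a : k ^+ n * orbit_bound a @[n --> \oo] --> (0 : R).
Proof.
rewrite -[X in _ --> X](mul0r (orbit_bound a)).
by apply: cvgMl; apply: cvg_expr; rewrite ger0_norm.
Qed.

Lemma orbit_cauchy a : Ms_cauchy m (fun n => iter n T a).
Proof.
apply: (Ms_cauchy_of_decay _ (orbit_decay_cvg0 a)) => i j.
have e_ge0 n : 0 <= k ^+ n * orbit_bound a.
  by rewrite mulr_ge0 ?exprn_ge0 ?orbit_bound_ge0.
have [ij|/ltnW ji] := leqP i j.
  have := orbit_decay a i (j - i); rewrite subnKC //.
  by have := e_ge0 j; lra.
have := orbit_decay a j (i - j); rewrite subnKC // (Ms_sym m_metric).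
by have := e_ge0 i; lra.
Qed.

(** Convergence is that of [m] itself, without correction: this is what the
    contraction transports from [u] to [T u]. *)
Lemma fixpoint_of_orbit_limit a u :
  m (iter n T a) (iter n T a) u @[n --> \oo] --> (0 : R) ->
  m u u u = 0 -> T u = u.
Proof.
set x := fun n => iter n T a => xu u0.
have Tu0 : m (T u) (T u) (T u) = 0.
  apply/eqP; rewrite eq_le m_ge0 andbT.
  by have := T_contr u u; rewrite u0 mulr0.
suff le0 : m u u (T u) <= 0.
  by apply/esym/Ms_eq0 => //; apply/eqP; rewrite eq_le m_ge0 andbT.
pose f n := m (x n) (x n) u.
apply: (@le0_of_cvg0 _ _ (fun n => 2 * f n.+1 + k * f n)) => [n|].
  have := Ms_triangle u (T u) (x n.+1).
  rewrite u0 !(Ms_sym m_metric _ (x n.+1)).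
  by have := T_contr (x n) u; rewrite /f /=; lra.
have -> : (0 : R) = 2 * 0 + k * 0 by rewrite !mulr0 addr0.
apply: cvgD; apply: cvgMr => //.
by rewrite -/(f \o S) (cvg_shiftS f).
Qed.

Lemma fixpoint_exists (a : X) : Ms_complete m -> exists u, T u = u.
Proof.
move=> /(_ _ (orbit_cauchy a)) [u [qu gapu]]; exists u.
set x := fun n => iter n T a in qu gapu.
pose e n := k ^+ n * orbit_bound a.
have e0 : e n @[n --> \oo] --> (0 : R) := orbit_decay_cvg0 a.
have min_le n : Ms_min m (x n) (x n) u <= e n.
  apply: le_trans (Ms_min_le1 _ _ _) _.
  by have := orbit_decay a n 0; rewrite addn0.
apply: (@fixpoint_of_orbit_limit a).
  apply: squeeze_cvg0 (cvg0D _ qu e0) => n; rewrite m_ge0 /= -/(x n).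
  by have := min_le n; lra.
(* The self-distance of [u] is below the maximum, hence below the gap between
   maximum and minimum plus the self-distance of [x n]. *)
apply/eqP; rewrite eq_le m_ge0 andbT.
apply: le0_of_cvg0 (cvg0D _ gapu e0) => n.
by have := min_le n; have := Ms_max_ge3 (x n) (x n) u; lra.
Qed.

End Contraction.
End MsMetricTheory.

Theorem theorem1 (R : realType) (X : Type) (X_nonempty : inhabited X)
    (m : X -> X -> X -> R) (m_metric : is_Ms_metric m)
    (m_complete : Ms_complete m) (T : X -> X)
    (T_contr : exists k : R, 0 <= k < 1 /\
       forall x y : X, m (T x) (T x) (T y) <= k * m x x y) :
  (exists! u : X, T u = u) /\ (forall u : X, T u = u -> m u u u = 0).
Proof.
case: T_contr => k [/andP[k0 k1] Tk]; case: X_nonempty => a; split.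
  have [u Tu] := fixpoint_exists m_metric k0 k1 Tk a m_complete.
  by exists u; split=> // v; exact: (fixpoint_unique m_metric k1 Tk).
by move=> u; exact: (fixpoint_self_eq0 m_metric k1 Tk).
Qed.
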